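(* Let $V$ be a 3-dimensional complex vector space with a Hermitian form $h$ of signature $(2,1)$. Let $p,q\in V_+$ be linearly independent positive vectors and set $$\Delta_H(p,q)=h(p,p)h(q,q)-|h(p,q)|^2 .$$ Then: (i) if $\Delta_H(p,q)>0$, then $L_p\cap L_q$ consists of exactly one (interior) point; (ii) if $\Delta_H(p,q)=0$, then $\mathcal C_p\cap\mathcal C_q$ consists of exactly one (boundary) point; (iii) if $\Delta_H(p,q)<0$, then $\overline{L_p}\cap\overline{L_q}=\varnothing$, where $\overline{L_p}=L_p\cup\mathcal C_p$. Equivalently, since $\Delta_H(p,q)=h(p,p)h(q,q)\,S_H(p,q)$ and the diagonal factors are positive, the sign of the polar spread $S_H(p,q)$ determines the intersection type in the same way. In the special case $h(p,q)=0$, equivalently $S_H(p,q)=1$, the geodesics $L_p$ and $L_q$ intersect orthogonally at an interior point.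
   Context: $h$ is linear in the first argument and conjugate-linear in the second. $V_-=\{z:h(z,z)<0\}$, $V_0=\{z\neq0:h(z,z)=0\}$, $V_+=\{z:h(z,z)>0\}$; $\mathbb{C}\mathrm{H}^2=\mathbb P(V_-)$, $\partial\mathbb{C}\mathrm{H}^2=\mathbb P(V_0)$. For $p\in V_+$, $p^\perp=\{z\in V:h(z,p)=0\}$, the complex geodesic polar to $p$ is $L_p=\mathbb P(p^\perp\cap V_-)$ and its boundary chain is $\mathcal C_p=\mathbb P(p^\perp\cap V_0)$. The polar (Hermitian) spread of positive vectors is $S_H(p,q)=1-\dfrac{|h(p,q)|^2}{h(p,p)h(q,q)}$. The tangent space at $x=[z]\in\mathbb{C}\mathrm{H}^2$ is $T_x\mathbb{C}\mathrm{H}^2\cong\operatorname{Hom}_{\mathbb C}(\mathbb Cz,z^\perp)$, with the inner product induced by the positive definite restriction of $h$ to $z^\perp$; two complex geodesics meeting at $x$ intersect orthogonally if their tangent spaces at $x$ are orthogonal. *)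

(* Defs.v *)
From HB Require Import structures.
From mathcomp Require Import all_boot all_order all_algebra sesquilinear.
From mathcomp Require Import complex classical_sets reals.

Set Implicit Arguments.
Unset Strict Implicit.
Unset Printing Implicit Defensive.

Import Order.TTheory GRing.Theory Num.Theory Num.Def.
Local Open Scope ring_scope.
Local Open Scope classical_set_scope.

(* The order on R[i] is the partial one: x < y means that y - x is a positive
   real number.  Since h z z, |h p q|^2, deltaH h p q and spreadH h p q all lie
   in the real line of R[i], the comparisons below are those of the reals. *)

Section ComplexHyperbolicPlane.
Variables (R : realType) (V : vectType R[i]).
Variable h : {hermitian_sym V for (@conjC R[i])}.

(* Sylvester's form: a basis in which h is diag(1, .., 1, -1, .., -1). *)
Definition has_signature (m n : nat) : Prop :=
  exists2 e : (m + n).-tuple V, basis_of fullv e &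
    forall i j : 'I_(m + n),
      h e`_i e`_j = if i == j then (if (i < m)%N then 1 else - 1) else 0.

Definition Vneg : set V := [set z | h z z < 0].
Definition Vnull : set V := [set z | z != 0 /\ h z z = 0].
Definition Vpos : set V := [set z | 0 < h z z].

(* Points of P(V) are the lines of V, as subspaces; A must not contain 0. *)
Definition projectivization (A : set V) : set {vspace V} :=
  [set <[z]>%VS | z in A].

Definition CH2 : set {vspace V} := projectivization Vneg.
Definition boundaryCH2 : set {vspace V} := projectivization Vnull.

(* The vectors z with h z p = 0. *)
Definition polar (p : V) : {vspace V} := orthov h <[p]>%VS.

Definition geodesic (p : V) : set {vspace V} :=
  projectivization ([set` polar p] `&` Vneg).
Definition chain (p : V) : set {vspace V} :=
  projectivization ([set` polar p] `&` Vnull).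
Definition geodesic_closure (p : V) : set {vspace V} := geodesic p `|` chain p.

Definition deltaH (p q : V) : R[i] := h p p * h q q - `|h p q| ^+ 2.
Definition spreadH (p q : V) : R[i] := 1 - `|h p q| ^+ 2 / (h p p * h q q).

(* T_x CH^2 = Hom(x, x^perp). *)
Definition tangent (x : {vspace V}) : Type :=
  'Hom(subvs_of x, subvs_of (orthov h x)).

(* The Hermitian inner product on Hom(x, x^perp) coming from the positive
   definite forms - h on x and h on x^perp; its value does not depend on the
   generator z of x. *)
Definition tangent_dot (x : {vspace V}) (phi psi : tangent x) : R[i] :=
  let z := vpick x in
  let u := vsproj x z in
  h (vsval (phi u)) (vsval (psi u)) / - h z z.

(* T_x P(W) = Hom(x, W :&: x^perp) inside Hom(x, x^perp), for W = polar p. *)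
Definition tangent_geodesic (p : V) (x : {vspace V}) : set (tangent x) :=
  [set phi : tangent x | forall u, vsval (phi u) \in polar p].

Definition meet_orthogonally_at (p q : V) (x : {vspace V}) : Prop :=
  (geodesic p `&` geodesic q) x /\
  forall phi psi : tangent x,
    tangent_geodesic p phi -> tangent_geodesic q psi -> tangent_dot phi psi = 0.

End ComplexHyperbolicPlane.

(* Main.v *)
(* For independent u, v the space u^perp :&: v^perp is a line C r, where r is
   the Lorentzian cross product of u and v, and h(r, r) = - Delta_H(u, v).
   Hence, for u = p and v = q, the sign of Delta_H decides whether the only
   candidate [r] for a common point of the closed geodesics is interior, on the
   boundary, or outside.  If h(p, q) = 0, the tangent lines of L_p and L_q at
   [r] are Hom(C r, C q) and Hom(C r, C p), which are orthogonal. *)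
Require Import Defs.
From HB Require Import structures.
From mathcomp Require Import all_boot all_order all_algebra sesquilinear.
From mathcomp Require Import complex classical_sets reals ring.

Set Implicit Arguments.
Unset Strict Implicit.
Unset Printing Implicit Defensive.

Import Order.TTheory GRing.Theory Num.Theory Num.Def.
Local Open Scope ring_scope.
Local Open Scope classical_set_scope.


(** Vanishing minors force rank at most one, and a nonzero [ai] fixes [c = bi / ai]. It is used
    twice below: to see that independent vectors have a nonzero cross product, and that a vector
    orthogonal to both is a multiple of its conjugate. *)
Lemma proportional_of_minors (K : fieldType) (a0 a1 a2 b0 b1 b2 : K) :
    [|| a0 != 0, a1 != 0 | a2 != 0] ->
    a0 * b1 = a1 * b0 -> a0 * b2 = a2 * b0 -> a1 * b2 = a2 * b1 ->
  exists c, [/\ b0 = c * a0, b1 = c * a1 & b2 = c * a2].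
Proof.
move=> /or3P[] a_neq0 e01 e02 e12.
- by exists (b0 / a0); split; apply: (mulfI a_neq0); rewrite ?e01 ?e02; field.
- by exists (b1 / a1); split; apply: (mulfI a_neq0); rewrite -?e01 ?e12; field.
- by exists (b2 / a2); split; apply: (mulfI a_neq0); rewrite -?e02 -?e12; field.
Qed.

Lemma line_scale (K : fieldType) (V : vectType K) (c : K) (v : V) :
  c != 0 -> (<[c *: v]> = <[v]>)%VS.
Proof.
move=> c_neq0; apply: subv_anti; rewrite -!memvE memvZ ?memv_line//=.
by apply/vlineP; exists c^-1; rewrite scalerK.
Qed.

Section PolarLines.
Variables (R : realType) (V : vectType R[i]).
Variable h : {hermitian_sym V for (@conjC R[i])}.
Implicit Types p q u v z : V.

Lemma herm_eq0_sym u v : h u v = 0 -> h v u = 0.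
Proof. by move/eqP; rewrite herm_eq0C => /eqP. Qed.

Lemma mem_polar p z : (z \in polar h p) = (h z p == 0).
Proof. exact: mem_orthov1. Qed.

Lemma hermZ (c : R[i]) z : h (c *: z) (c *: z) = `|c| ^+ 2 * h z z.
Proof. by rewrite linearZl_LR /= linearZr_LR /= normCK mulrA. Qed.

(** Packages a Sylvester basis as a coordinate map [f], so that facts about [h] become polynomial
    identities within reach of [ring]. *)
Lemma signature21_coords : has_signature h 2 1 ->
  exists f : R[i] -> R[i] -> R[i] -> V,
  [/\ forall v, exists a b c, v = f a b c,
      f 0 0 0 = 0,
      forall k a b c, k *: f a b c = f (k * a) (k * b) (k * c)
    & forall a b c a' b' c',
        h (f a b c) (f a' b' c') = a * a'^* + b * b'^* - c * c'^*].
Proof.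
move=> [e e_basis he].
pose i0 : 'I_(2 + 1) := ord0.
pose i1 : 'I_(2 + 1) := Ordinal (isT : (1 < 2 + 1)%N).
pose i2 : 'I_(2 + 1) := Ordinal (isT : (2 < 2 + 1)%N).
exists (fun a b c => a *: e`_i0 + b *: e`_i1 + c *: e`_i2); split.
- move=> v; exists (coord e i0 v), (coord e i1 v), (coord e i2 v).
  rewrite {1}(coord_basis e_basis (memvf v)) big_ord_recr big_ord_recr /=.
  rewrite big_ord_recr big_ord0 /= add0r.
  by do 2?congr (_ + _); congr (coord e _ v *: _); apply: val_inj.
- by rewrite !scale0r !addr0.
- by move=> k a b c; rewrite !scalerDr !scalerA.
- move=> a b c a' b' c'.
  rewrite !(linearDl, linearDr) !(linearZl_LR, linearZr_LR) /=.
  rewrite (he i0 i0) (he i0 i1) (he i0 i2) (he i1 i0) (he i1 i1) (he i1 i2).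
  by rewrite (he i2 i0) (he i2 i1) (he i2 i2) /=; ring.
Qed.

(* The generator is the conjugate of the Euclidean cross product of J u and
   J v, where J = diag(1, 1, -1); its norm is given by Lagrange's identity. *)
Lemma perp_pair_line u v : has_signature h 2 1 -> free [:: u; v] ->
  exists r, [/\ r != 0, h r r = - deltaH h u v
    & forall z, h z u = 0 /\ h z v = 0 <-> exists c, z = c *: r].
Proof.
move=> /signature21_coords[f [f_surj f0 fZ hf]].
have fnz a b c : f a b c != 0 -> [|| a != 0, b != 0 | c != 0].
  apply: contra_neqT; rewrite !negb_or !negbK => /and3P[/eqP-> /eqP-> /eqP->].
  exact: f0.
have [u0 [u1 [u2 ->]]] := f_surj u; have [v0 [v1 [v2 ->]]] := f_surj v.
rewrite free_cons seq1_free span_seq1 => /andP[u_notin v_neq0].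
pose r0 := u2 * v1 - u1 * v2; pose r1 := u0 * v2 - u2 * v0.
pose r2 := u0 * v1 - u1 * v0.
(* If all three minors vanished, [u] would be a multiple of [v], against freeness. *)
have r_nz : [|| r0^* != 0, r1^* != 0 | r2^* != 0].
  apply: contraNT u_notin; rewrite !negb_or !negbK !conjC_eq0.
  move=> /and3P[/eqP r00 /eqP r10 /eqP r20].
  have [c [-> -> ->]] : exists c, [/\ u0 = c * v0, u1 = c * v1 & u2 = c * v2].
    apply: proportional_of_minors (fnz _ _ _ v_neq0) _ _ _; apply/eqP.
    - by rewrite -subr_eq0 -oppr_eq0 -r20 /r2; apply/eqP; ring.
    - by rewrite -subr_eq0 -oppr_eq0 -r10 /r1; apply/eqP; ring.
    - by rewrite -subr_eq0 -r00 /r0; apply/eqP; ring.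
  by apply/vlineP; exists c; rewrite fZ.
exists (f r0^* r1^* r2^*); split.
(* Injectivity of [f] is not among its listed properties; the coordinates of the generator are
   recovered, up to sign, by pairing it with [f 1 0 0], [f 0 1 0] and [f 0 0 1]. *)
- apply: contraTneq r_nz => r_eq0.
  have fr0 a b c : r0^* * a^* + r1^* * b^* - r2^* * c^* = 0.
    by rewrite -hf r_eq0 linear0l.
  have := fr0 1 0 0; have := fr0 0 1 0; have := fr0 0 0 1.
  rewrite conjC1 conjC0 !mulr0 !mulr1 !addr0 !subr0 !add0r.
  by move=> /eqP; rewrite oppr_eq0 => /eqP-> -> ->; rewrite eqxx.
- rewrite /deltaH normCK !hf /r0 /r1 /r2 !(rmorphB, rmorphD, rmorphM) /=.
  by rewrite !conjCK; ring.
- move=> z; split=> [|[c ->]]; last first.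
    by rewrite fZ !hf /r0 /r1 /r2 !(rmorphB, rmorphM) /=; split; ring.
  have [z0 [z1 [z2 ->]]] := f_surj z; rewrite !hf => -[zu zv].
  (* The two zeros stand for [h z v] and [h z u]. The weights [w], [w'] chosen below eliminate one
     coordinate of [z] from these two equations, which leaves one minor of [z] against the
     generator. *)
  have minor (x y w w' : R[i]) : x - y = w * 0 - w' * 0 -> x = y.
    by rewrite !mulr0 subrr => /subr0_eq.
  have [c [-> -> ->]] :
      exists c, [/\ z0 = c * r0^*, z1 = c * r1^* & z2 = c * r2^*].
    apply: proportional_of_minors r_nz _ _ _;
      [apply: (minor _ _ u2^* v2^*) | apply: (minor _ _ u1^* v1^*)
      |apply: (minor _ _ (- u0^*) (- v0^*))];
      rewrite -{1}zv -zu /r0 /r1 /r2 !(rmorphB, rmorphM) /=; ring.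
  by exists c; rewrite fZ.
Qed.

Lemma orthogonal_free_pair u v :
  h u u != 0 -> v != 0 -> h u v = 0 -> free [:: u; v].
Proof.
move=> huu v_neq0 huv; rewrite free_cons seq1_free v_neq0 andbT span_seq1.
apply: contra huu => /vlineP[c u_eq].
by rewrite {2}u_eq linearZr_LR /= huv mulr0.
Qed.

Section TwoPolars.
Variables p q r : V.
Hypothesis perp_pq :
  forall z, h z p = 0 /\ h z q = 0 <-> exists c, z = c *: r.

(** Representatives of a common line, taken from the two sides, are proportional, so one of them is
    orthogonal to both [p] and [q]. As [A] is an arbitrary set, membership is only obtained for some
    multiple of [r]. *)
Lemma projectivization_meet (A : set V) x :
    (forall z, A z -> z != 0) ->
    (projectivization ([set` polar h p] `&` A) `&`
     projectivization ([set` polar h q] `&` A)) x ->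
  exists2 c, c != 0 /\ A (c *: r) & x = <[r]>%VS.
Proof.
move=> A_neq0 [[z [zp Az] <-] [w [wq Aw] wz]].
have /vlineP[k z_eq] : z \in <[w]>%VS by rewrite wz memv_line.
have zq : h z q = 0.
  by move: wq; rewrite /= mem_polar z_eq linearZl_LR /= => /eqP->; rewrite mulr0.
move: zp; rewrite /= mem_polar => /eqP zp.
have [c z_r] := (perp_pq z).1 (conj zp zq).
have c_neq0 : c != 0.
  by apply: contraTneq (A_neq0 _ Az) => c0; rewrite z_r c0 scale0r eqxx.
by exists c; rewrite -?z_r ?line_scale//; rewrite z_r line_scale.
Qed.

Lemma projectivization_meetE (A : set V) :
    (forall z, A z -> z != 0) -> A r ->
  projectivization ([set` polar h p] `&` A) `&`
    projectivization ([set` polar h q] `&` A) = [set <[r]>%VS].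
Proof.
move=> A_neq0 Ar.
have [rp rq] := (perp_pq r).2 (ex_intro _ 1 (esym (scale1r r))).
apply/seteqP; split=> [x /(projectivization_meet A_neq0)[] //|_ ->].
by split; exists r; rewrite //= mem_polar ?rp ?rq eqxx.
Qed.

End TwoPolars.

Lemma Vneg_neq0 z : Vneg h z -> z != 0.
Proof. by apply: contraTneq => ->; rewrite linear0l ltxx. Qed.

Lemma Vnull_neq0 z : Vnull h z -> z != 0.
Proof. by case. Qed.

Hypothesis sgn_h : has_signature h 2 1.

Lemma geodesics_meet p q : free [:: p; q] -> 0 < deltaH h p q ->
  exists2 x, CH2 h x & geodesic h p `&` geodesic h q = [set x].
Proof.
move=> /(perp_pair_line sgn_h)[r [r_neq0 hr perp_pq]] d_gt0.
have r_neg : Vneg h r by rewrite /Vneg /= hr oppr_lt0.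
exists <[r]>%VS; first by exists r.
exact: projectivization_meetE perp_pq _ Vneg_neq0 r_neg.
Qed.

Lemma chains_meet p q : free [:: p; q] -> deltaH h p q = 0 ->
  exists2 x, boundaryCH2 h x & chain h p `&` chain h q = [set x].
Proof.
move=> /(perp_pair_line sgn_h)[r [r_neq0 hr perp_pq]] d0.
have r_null : Vnull h r by split; rewrite // hr d0 oppr0.
exists <[r]>%VS; first by exists r.
exact: projectivization_meetE perp_pq _ Vnull_neq0 r_null.
Qed.

(** With a single projectivization, [projectivization_meet] handles all pairings of interior and
    boundary points at once. *)
Lemma geodesic_closureE p : geodesic_closure h p =
  projectivization ([set` polar h p] `&` (Vneg h `|` Vnull h)).
Proof. by rewrite setIUr /projectivization image_setU. Qed.

Lemma closures_disjoint p q : free [:: p; q] -> deltaH h p q < 0 ->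
  geodesic_closure h p `&` geodesic_closure h q = set0.
Proof.
move=> /(perp_pair_line sgn_h)[r [r_neq0 hr perp_pq]] d_lt0.
rewrite !geodesic_closureE -subset0 => x.
case/(projectivization_meet perp_pq) => [z [/Vneg_neq0|/Vnull_neq0] //|].
move=> c [c_neq0 cr] _.
(* Now [r] is positive, and so is each nonzero multiple, which can be neither negative nor null. *)
have cr_gt0 : 0 < h (c *: r) (c *: r).
  by rewrite hermZ hr mulr_gt0 ?exprn_gt0 ?normr_gt0 ?oppr_gt0.
case: cr => [/(lt_trans cr_gt0)|[_ cr0]]; first by rewrite ltxx.
by move: cr_gt0; rewrite cr0 ltxx.
Qed.

(* Since h p q = 0 and x = <[r]> is orthogonal to both p and q, the vectors of
   p^perp in x^perp are multiples of q, and those of q^perp multiples of p. *)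
Lemma orthogonal_geodesics p q : Vpos h p -> Vpos h q -> h p q = 0 ->
  exists2 x, CH2 h x & meet_orthogonally_at h p q x.
Proof.
rewrite /Vpos /= => p_pos q_pos hpq; have hqp := herm_eq0_sym hpq.
have pos_neq0 z : 0 < h z z -> z != 0.
  by apply: contraTneq => ->; rewrite linear0l ltxx.
have pq_free : free [:: p; q].
  by apply: orthogonal_free_pair hpq; rewrite ?pos_neq0 ?gt_eqF.
have [r [r_neq0 hr perp_pq]] := perp_pair_line sgn_h pq_free.
have [rp rq] := (perp_pq r).2 (ex_intro _ 1 (esym (scale1r r))).
have r_neg : Vneg h r.
  by rewrite /Vneg /= hr oppr_lt0 /deltaH hpq normr0 expr0n subr0 mulr_gt0.
(* A second cross product, of [p] and [r]: the line orthogonal to both contains [q] and every value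
   of [phi]. *)
have pr_free : free [:: p; r].
  by apply: orthogonal_free_pair (herm_eq0_sym rp); rewrite ?gt_eqF.
have [s [s_neq0 _ perp_pr]] := perp_pair_line sgn_h pr_free.
have [a q_eq] := (perp_pr q).1 (conj hqp (herm_eq0_sym rq)).
exists <[r]>%VS; first by exists r.
split; first by rewrite /geodesic (projectivization_meetE perp_pq Vneg_neq0).
move=> phi psi phi_p psi_q; rewrite /tangent_dot.
set v := vsval _; set w := vsval _.
have vp : h v p = 0 by apply/eqP; rewrite -mem_polar; apply: phi_p.
have wq : h w q = 0 by apply/eqP; rewrite -mem_polar; apply: psi_q.
(* The codomain of [phi] is the orthogonal of the line through [r]. *)
have vr : h v r = 0 by apply/eqP; rewrite -mem_orthov1; apply: subvsP.
have [b v_eq] := (perp_pr v).1 (conj vp vr).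
have a_neq0 : a != 0.
  by apply: contraTneq (pos_neq0 _ q_pos) => a0; rewrite q_eq a0 scale0r eqxx.
(* Since [w] is orthogonal to [q], the numerator of [tangent_dot] vanishes, whichever generator
   [vpick] selects. *)
have -> : v = (b / a) *: q by rewrite v_eq q_eq scalerA divfK.
by rewrite linearZl_LR /= (herm_eq0_sym wq) mulr0 mul0r.
Qed.

Lemma deltaHE p q : Vpos h p -> Vpos h q ->
  deltaH h p q = h p p * h q q * spreadH h p q.
Proof.
move=> p_pos q_pos; rewrite /spreadH mulrBr mulr1 mulrCA divff ?mulr1//.
by rewrite mulf_neq0 ?gt_eqF.
Qed.

End PolarLines.

Theorem proposition5p4 (R : realType) (V : vectType R[i])
    (h : {hermitian_sym V for (@conjC R[i])})
    (dimV : \dim {:V} = 3%N) (sgn_h : has_signature h 2 1)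
    (p q : V) (p_pos : Vpos h p) (q_pos : Vpos h q)
    (pq_free : free [:: p; q]) :
  [/\
      [/\ 0 < deltaH h p q ->
            exists2 x, CH2 h x & geodesic h p `&` geodesic h q = [set x],
          deltaH h p q = 0 ->
            exists2 x, boundaryCH2 h x & chain h p `&` chain h q = [set x]
        & deltaH h p q < 0 ->
            geodesic_closure h p `&` geodesic_closure h q = set0],
      deltaH h p q = h p p * h q q * spreadH h p q,
      [/\ 0 < spreadH h p q ->
            exists2 x, CH2 h x & geodesic h p `&` geodesic h q = [set x],
          spreadH h p q = 0 ->
            exists2 x, boundaryCH2 h x & chain h p `&` chain h q = [set x]
        & spreadH h p q < 0 ->
            geodesic_closure h p `&` geodesic_closure h q = set0],
      h p q = 0 <-> spreadH h p q = 1
    & h p q = 0 ->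
        exists2 x, CH2 h x & meet_orthogonally_at h p q x].

Proof.
have hpq_gt0 : 0 < h p p * h q q by rewrite mulr_gt0.
have dE := deltaHE p_pos q_pos.
(* The positive factor [h p p * h q q] carries the sign conditions from [deltaH] to [spreadH]. *)
have S_gt0 : (0 < deltaH h p q) = (0 < spreadH h p q) by rewrite dE pmulr_rgt0.
have S_lt0 : (deltaH h p q < 0) = (spreadH h p q < 0) by rewrite dE pmulr_rlt0.
split=> //.
- by split; [apply: geodesics_meet | apply: chains_meet | apply: closures_disjoint].
- split; rewrite -?S_gt0 -?S_lt0.
  + exact: geodesics_meet.
  + by move=> S0; apply: chains_meet; rewrite // dE S0 mulr0.
  + exact: closures_disjoint.
- rewrite /spreadH; split=> [->|/eqP].
    by rewrite normr0 expr0n mul0r subr0.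
  rewrite -subr_eq0 addrAC subrr sub0r oppr_eq0 mulf_eq0 invr_eq0.
  by rewrite (gt_eqF hpq_gt0) orbF expf_eq0 normr_eq0 => /eqP.
- exact: orthogonal_geodesics.
Qed.
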